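(* Let $k$ be a commutative ring with $1$, let $A(B)^C$ be a coalgebra-Galois extension over $k$, and let $(A,C)_\psi$ be its canonical entwining structure, with $\psi(c\otimes a)=a_\alpha\otimes c^\alpha$ (summation understood). Then $B\hookrightarrow A$ is a split extension if and only if there exists a $k$-linear map $\phi:C\to A$ such that (i) $\psi(c_{(1)}\otimes\phi(c_{(2)}))=\phi(c)\rho^A(1_A)$ for all $c\in C$; (ii) $\sum_ia^i\phi(c_i)=1_A$, where $\sum_ia^i\otimes c_i=\rho^A(1_A)$; (iii) $b_\alpha\phi(c^\alpha)=\phi(c)b$ for all $b\in B$, $c\in C$.
   Context: Algebras are associative unital $k$-algebras, coalgebras coassociative counital $k$-coalgebras, $\otimes=\otimes_k$; $\Delta_C(c)=c_{(1)}\otimes c_{(2)}$ is the coproduct of $C$. Coalgebra-Galois extension. Let $C$ be a coalgebra, $A$ an algebra and a right $C$-comodule with coaction $\rho^A:A\to A\otimes C$, and let $B=\{b\in A\mid\rho^A(ba)=b\rho^A(a)\text{ for all }a\in A\}$, a subalgebra of $A$ ($A$ acts on $A\otimes C$ by left multiplication on the first factor). $B\hookrightarrow A$ is a coalgebra-Galois extension, denoted $A(B)^C$, if the map $\mathrm{can}:A\otimes_BA\to A\otimes C$, $a\otimes a'\mapsto a\rho^A(a')$, is bijective. The associated canonical entwining structure is $(A,C)_\psi$ with $\psi:C\otimes A\to A\otimes C$, $\psi(c\otimes a)=\mathrm{can}(\mathrm{can}^{-1}(1_A\otimes c)a)$. An extension of algebras $B\hookrightarrow A$ is split if there exists a unital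 $(B,B)$-bimodule map $E:A\to B$ (unital: $E(1_A)=1_B$). *)

(* Defs.v *)
From HB Require Import structures.
From mathcomp Require Import all_boot all_order all_algebra.
From mathcomp Require Import boolp classical_sets.
From mathcomp.multinomials Require Import freeg.

Set Implicit Arguments.
Unset Strict Implicit.
Unset Printing Implicit Defensive.

Import GRing.Theory.
Local Open Scope ring_scope.
Local Open Scope quotient_scope.

Reserved Notation "M ⊗ N" (at level 40, left associativity).
Reserved Notation "m ⊗ₜ n" (at level 40, left associativity).

(* The tensor product of a right [S]-module [M] and a left [S]-module [N] is
   the quotient of the free abelian group on [M * N] by the subgroup generated
   by the usual relations.  Only the two actions [r] and [l] of the scalars are
   recorded, so that [S] may be a non-commutative ring. *)
Section Tensor.
Context (S : Type) (M N : zmodType) (r : M -> S -> M) (l : S -> N -> N).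

Inductive tens_rel : {freeg (M * N) / int} -> Prop :=
| TRel0 : tens_rel 0
| TRelB x y of tens_rel x & tens_rel y : tens_rel (x - y)
| TRelDl m m' n : tens_rel (<< (m + m', n) >> - << (m, n) >> - << (m', n) >>)
| TRelDr m n n' : tens_rel (<< (m, n + n') >> - << (m, n) >> - << (m, n') >>)
| TRelS m s n : tens_rel (<< (r m s, n) >> - << (m, l s n) >>).

Definition tens_relb (x : {freeg (M * N) / int}) : bool := `[< tens_rel x >].

Fact tens_relb_closed : zmod_closed tens_relb.
Proof.
split=> [|x y /asboolP hx /asboolP hy]; apply/asboolP; first exact: TRel0.
exact: TRelB.
Qed.

HB.instance Definition _ :=
  GRing.isZmodClosed.Build {freeg (M * N) / int} tens_relb tens_relb_closed.

Definition tideal : zmodClosed {freeg (M * N) / int} :=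
  GRing.ZmodClosed.clone _ tens_relb _.

Definition tensor : Type := {ideal_quot tideal}.

HB.instance Definition _ := GRing.Zmodule.on tensor.

Definition tpi : {freeg (M * N) / int} -> tensor := \pi_({ideal_quot tideal}).

Definition tpure (m : M) (n : N) : tensor := tpi << (m, n) >>.

Record balanced (P : zmodType) (f : M -> N -> P) : Prop := Balanced {
  balancedDl : forall m m' n, f (m + m') n = f m n + f m' n;
  balancedDr : forall m n n', f m (n + n') = f m n + f m n';
  balancedS : forall m s n, f (r m s) n = f m (l s n) }.

(* Defined for every [f] through a representative of the class [t]; it is the
   additive map induced by [f] when [f] is balanced, see [tliftE] and
   [tlift_zmod_morphism]. *)
Definition tlift (P : zmodType) (f : M -> N -> P) (t : tensor) : P :=
  fglift (fun mn => f mn.1 mn.2 : zmodule P) (repr (t : {ideal_quot tideal})).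

Lemma tpi_zmod_morphism : zmod_morphism tpi.
Proof. exact: (raddfB \pi_({ideal_quot tideal})). Qed.

HB.instance Definition _ :=
  GRing.isZmodMorphism.Build _ tensor tpi tpi_zmod_morphism.

Lemma tpiP x y : tpi x = tpi y <-> tens_rel (x - y).
Proof.
split=> [/eqP|h].
  by rewrite -[_ == _](Quotient.idealrBE tideal) => /asboolP.
by apply/eqP; rewrite -[_ == _](Quotient.idealrBE tideal); apply/asboolP.
Qed.

Lemma tpi_repr t : tpi (repr (t : {ideal_quot tideal})) = t.
Proof. exact: reprK. Qed.

Lemma tpureDl m m' n : tpure (m + m') n = tpure m n + tpure m' n.
Proof.
rewrite /tpure -raddfD; apply/tpiP.
by rewrite opprD addrA; apply: TRelDl.
Qed.

Lemma tpureDr m n n' : tpure m (n + n') = tpure m n + tpure m n'.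
Proof.
rewrite /tpure -raddfD; apply/tpiP.
by rewrite opprD addrA; apply: TRelDr.
Qed.

Lemma tpureS m s n : tpure (r m s) n = tpure m (l s n).
Proof. by apply/tpiP; apply: TRelS. Qed.

Lemma tpure_balanced : balanced tpure.
Proof. by split; [exact: tpureDl | exact: tpureDr | exact: tpureS]. Qed.

Lemma tpure0l n : tpure 0 n = 0.
Proof. by apply: (addIr (tpure 0 n)); rewrite -tpureDl !add0r. Qed.

Lemma tpureNl m n : tpure (- m) n = - tpure m n.
Proof. by apply: (addIr (tpure m n)); rewrite -tpureDl !addNr tpure0l. Qed.

Lemma tensor_ind (P : tensor -> Prop) : P 0 ->
  (forall m n, P (tpure m n)) -> (forall t u, P t -> P u -> P (t + u)) ->
  forall t, P t.
Proof.
move=> P0 Pp PD t; rewrite -[t]tpi_repr; elim/freeg_ind_dom0: (repr _).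
  by rewrite raddf0.
move=> k [m n] D _ _ PDD; rewrite raddfD; apply: (PD) => //.
have -> : << k *g (m, n) >> = << (m, n) >> *~ k :> {freeg (M * N) / int}.
  by apply/eqP/freeg_eqP => x;
     rewrite raddfMz /= !coeffU mul1r -mulrzr intz mulrC.
rewrite raddfMz -/(tpure m n).
have PMn m' i : P (tpure m' n *+ i).
  by elim: i => [|i IH]; rewrite ?mulr0n // mulrS; apply: (PD).
case: k => i; first exact: PMn.
by rewrite NegzE mulrNz -mulNrz -tpureNl; apply: PMn.
Qed.

Section Lift.
Context (P : zmodType) (f : M -> N -> P) (hf : balanced f).

Let lift (x : {freeg (M * N) / int}) : zmodule P :=
  fglift (fun mn => f mn.1 mn.2 : zmodule P) x.

Let liftB x y : lift (x - y) = lift x - lift y.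
Proof. exact: lift_is_additive. Qed.

Let liftU m n : lift << (m, n) >> = f m n.
Proof. by rewrite /lift liftU scale1r. Qed.

Let lift_rel x : tens_rel x -> lift x = 0.
Proof.
elim=> [|{}x y _ hx _ hy|m m' n|m n n'|m s n].
- by have := liftB 0 0; rewrite !subrr.
- by rewrite liftB hx hy subrr.
- by rewrite !liftB !liftU (balancedDl hf) -addrA -opprD subrr.
- by rewrite !liftB !liftU (balancedDr hf) -addrA -opprD subrr.
- by rewrite !liftB !liftU (balancedS hf) subrr.
Qed.

Let tlift_pi x : tlift f (tpi x) = lift x.
Proof.
rewrite /tlift -/(lift _); apply/eqP; rewrite -subr_eq0 -liftB.
by apply/eqP/lift_rel/tpiP; rewrite tpi_repr.
Qed.

Lemma tliftE m n : tlift f (tpure m n) = f m n.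
Proof. by rewrite tlift_pi liftU. Qed.

Lemma tlift_zmod_morphism : zmod_morphism (tlift f).
Proof.
by move=> t u; rewrite -[t]tpi_repr -[u]tpi_repr -raddfB !tlift_pi liftB.
Qed.

Lemma tlift0 : tlift f 0 = 0.
Proof. by have := tlift_zmod_morphism 0 0; rewrite !subrr. Qed.

Lemma tliftN t : tlift f (- t) = - tlift f t.
Proof. by have := tlift_zmod_morphism 0 t; rewrite !sub0r tlift0 sub0r. Qed.

Lemma tliftD t u : tlift f (t + u) = tlift f t + tlift f u.
Proof. by have := tlift_zmod_morphism t (- u); rewrite opprK tliftN opprK. Qed.

End Lift.

End Tensor.

Section TensorK.
Context (k : comPzRingType) (M N : lmodType k).

Definition tensk : Type :=
  tensor (fun (m : M) (a : k) => a *: m) (fun (a : k) (n : N) => a *: n).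

HB.instance Definition _ := GRing.Zmodule.on tensk.

Definition tenskp (m : M) (n : N) : tensk := tpure _ _ m n.

Lemma tenskpDl m m' n : tenskp (m + m') n = tenskp m n + tenskp m' n.
Proof. exact: tpureDl. Qed.

Lemma tenskpDr m n n' : tenskp m (n + n') = tenskp m n + tenskp m n'.
Proof. exact: tpureDr. Qed.

Lemma tenskpS m a n : tenskp (a *: m) n = tenskp m (a *: n).
Proof. exact: tpureS. Qed.

Lemma tensk_ind (P : tensk -> Prop) : P 0 ->
  (forall m n, P (tenskp m n)) -> (forall t u, P t -> P u -> P (t + u)) ->
  forall t, P t.
Proof. exact: tensor_ind. Qed.

Definition kbalanced (P : zmodType) (f : M -> N -> P) : Prop :=
  balanced (fun (m : M) (a : k) => a *: m) (fun (a : k) (n : N) => a *: n) f.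

Definition tkscale (a : k) (t : tensk) : tensk :=
  tlift (fun m n => tenskp (a *: m) n) t.

Lemma tkscale_balanced a : kbalanced (fun m n => tenskp (a *: m) n).
Proof.
split=> [m m' n|m n n'|m b n].
- by rewrite scalerDr tenskpDl.
- by rewrite tenskpDr.
- by rewrite scalerA mulrC -scalerA tenskpS.
Qed.

Lemma tkscaleE a m n : tkscale a (tenskp m n) = tenskp (a *: m) n.
Proof. exact/tliftE/tkscale_balanced. Qed.

Lemma tkscale0 a : tkscale a 0 = 0.
Proof. exact/tlift0/tkscale_balanced. Qed.

Lemma tkscaleDr a : {morph tkscale a : t u / t + u}.
Proof. exact/tliftD/tkscale_balanced. Qed.

Lemma tkscaleA a b t : tkscale a (tkscale b t) = tkscale (a * b) t.
Proof.
elim/tensk_ind: t => [|m n|t u ht hu]; rewrite ?tkscale0 //.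
  by rewrite !tkscaleE scalerA.
by rewrite !tkscaleDr ht hu.
Qed.

Lemma tkscale1 : left_id 1 tkscale.
Proof.
elim/tensk_ind => [|m n|t u ht hu]; rewrite ?tkscale0 //.
  by rewrite tkscaleE scale1r.
by rewrite tkscaleDr ht hu.
Qed.

Lemma tkscaleDl t : {morph tkscale^~ t : a b / a + b}.
Proof.
move=> a b /=.
elim/tensk_ind: t => [|m n|t u ht hu]; rewrite ?tkscale0 ?addr0 //.
  by rewrite !tkscaleE scalerDl tenskpDl.
by rewrite !tkscaleDr ht hu addrACA.
Qed.

HB.instance Definition _ := GRing.Zmodule_isLmodule.Build k tensk
  tkscaleA tkscale1 tkscaleDr tkscaleDl.

Lemma tenskZl a m n : a *: tenskp m n = tenskp (a *: m) n.
Proof. exact: tkscaleE. Qed.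

End TensorK.

Notation "M ⊗ N" := (tensk M N).
Notation "m ⊗ₜ n" := (tenskp m n).

Section TensorMaps.
Context (k : comPzRingType).
Implicit Types M N P : lmodType k.

Lemma tlift_scalable M N P (f : M -> N -> P) : kbalanced f ->
  (forall a m n, f (a *: m) n = a *: f m n) ->
  forall a (t : M ⊗ N), tlift f (a *: t) = a *: tlift f t.
Proof.
move=> hf fZ a; elim/tensk_ind => [|m n|t u ht hu].
- by rewrite scaler0 (tlift0 hf) scaler0.
- by rewrite tenskZl !(tliftE hf) fZ.
- by rewrite scalerDr !(tliftD hf) scalerDr ht hu.
Qed.

Definition tmap M M' N N' (f : {linear M -> M'}) (g : {linear N -> N'})
  (t : M ⊗ N) : M' ⊗ N' := tlift (fun m n => f m ⊗ₜ g n) t.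

Lemma tmap_balanced M M' N N' (f : {linear M -> M'}) (g : {linear N -> N'}) :
  kbalanced (fun m n => f m ⊗ₜ g n).
Proof.
split=> [m m' n|m n n'|m a n].
- by rewrite linearD tenskpDl.
- by rewrite linearD tenskpDr.
- by rewrite !linearZ tenskpS.
Qed.

Lemma tmapE M M' N N' (f : {linear M -> M'}) (g : {linear N -> N'}) m n :
  tmap f g (m ⊗ₜ n) = f m ⊗ₜ g n.
Proof. exact/tliftE/tmap_balanced. Qed.

Definition tassoc M N P (t : (M ⊗ N) ⊗ P) : M ⊗ (N ⊗ P) :=
  tlift (fun (u : M ⊗ N) p => tlift (fun m n => m ⊗ₜ (n ⊗ₜ p)) u) t.

Lemma tassoc_balanced_in M N P (p : P) :
  kbalanced (fun (m : M) (n : N) => m ⊗ₜ (n ⊗ₜ p)).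
Proof.
split=> [m m' n|m n n'|m a n].
- by rewrite tenskpDl.
- by rewrite tenskpDl tenskpDr.
- by rewrite tenskpS tenskZl.
Qed.

Lemma tassoc_balanced M N P :
  kbalanced (fun (u : M ⊗ N) (p : P) => tlift (fun m n => m ⊗ₜ (n ⊗ₜ p)) u).
Proof.
have hin := tassoc_balanced_in.
split=> [u u' p|u p p'|u a p].
- by rewrite (tliftD (hin _ _ _ p)).
- elim/tensk_ind: u => [|m n|u u' hu hu'].
  + by rewrite !(tlift0 (hin _ _ _ _)) addr0.
  + by rewrite !(tliftE (hin _ _ _ _)) !tenskpDr.
  + by rewrite !(tliftD (hin _ _ _ _)) hu hu' addrACA.
- elim/tensk_ind: u => [|m n|u u' hu hu'].
  + by rewrite scaler0 !(tlift0 (hin _ _ _ _)).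
  + rewrite tenskZl !(tliftE (hin _ _ _ _)).
    by rewrite tenskpS tenskZl tenskpS.
  + by rewrite scalerDr !(tliftD (hin _ _ _ _)) hu hu'.
Qed.

Lemma tassocE M N P (m : M) (n : N) (p : P) :
  tassoc ((m ⊗ₜ n) ⊗ₜ p) = m ⊗ₜ (n ⊗ₜ p).
Proof.
rewrite /tassoc [LHS](tliftE (tassoc_balanced M N P)).
by rewrite (tliftE (tassoc_balanced_in _ _ p)).
Qed.

Lemma scalarl_balanced M N (e : {scalar M}) :
  kbalanced (fun (m : M) (n : N) => e m *: n).
Proof.
split=> [m m' n|m n n'|m a n].
- by rewrite linearD scalerDl.
- by rewrite scalerDr.
- by rewrite scalarZ scalerA mulrC.
Qed.

Lemma scalarr_balanced M N (e : {scalar N}) :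
  kbalanced (fun (m : M) (n : N) => e n *: m).
Proof.
split=> [m m' n|m n n'|m a n].
- by rewrite scalerDr.
- by rewrite linearD scalerDl.
- by rewrite scalarZ scalerA mulrC.
Qed.

End TensorMaps.

HB.mixin Record isCoalgebra (k : comPzRingType) C of GRing.Lmodule k C := {
  comul : {linear C -> C ⊗ C};
  counit : {scalar C};
  comulA : forall c,
    tassoc (tmap comul idfun (comul c)) = tmap idfun comul (comul c);
  counit_comull : forall c, tlift (fun c1 c2 => counit c1 *: c2) (comul c) = c;
  counit_comulr : forall c, tlift (fun c1 c2 => counit c2 *: c1) (comul c) = c }.

#[short(type="coalgType")]
HB.structure Definition Coalgebra (k : comPzRingType) :=
  {C of GRing.Lmodule k C & isCoalgebra k C}.

(* [algType] requires [1 != 0], whereas an associative unital [k]-algebra may be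
   zero. *)
Structure pzAlgType (k : comPzRingType) : Type := PzAlgType {
  pzalg_lmod : lmodType k;
  pzalg_one : pzalg_lmod;
  pzalg_mul : pzalg_lmod -> pzalg_lmod -> pzalg_lmod;
  pzalg_mulA : associative pzalg_mul;
  pzalg_mul1r : left_id pzalg_one pzalg_mul;
  pzalg_mulr1 : right_id pzalg_one pzalg_mul;
  pzalg_mulrDl : left_distributive pzalg_mul +%R;
  pzalg_mulrDr : right_distributive pzalg_mul +%R;
  pzalg_scaleAl : forall a x y, a *: pzalg_mul x y = pzalg_mul (a *: x) y;
  pzalg_scaleAr : forall a x y, a *: pzalg_mul x y = pzalg_mul x (a *: y) }.

Definition pzalg_sort (k : comPzRingType) (A : pzAlgType k) : Type :=
  pzalg_lmod A.
Coercion pzalg_sort : pzAlgType >-> Sortclass.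

Section PzAlg.
Context (k : comPzRingType) (A : pzAlgType k).
HB.instance Definition _ := GRing.Lmodule.copy (pzalg_sort A) (pzalg_lmod A).
HB.instance Definition _ := GRing.Zmodule_isPzRing.Build (pzalg_sort A)
  (@pzalg_mulA k A) (@pzalg_mul1r k A) (@pzalg_mulr1 k A)
  (@pzalg_mulrDl k A) (@pzalg_mulrDr k A).
End PzAlg.

Lemma pzscalerAl (k : comPzRingType) (A : pzAlgType k) (a : k) (x y : A) :
  a *: (x * y) = (a *: x) * y.
Proof. exact: pzalg_scaleAl. Qed.

Lemma pzscalerAr (k : comPzRingType) (A : pzAlgType k) (a : k) (x y : A) :
  a *: (x * y) = x * (a *: y).
Proof. exact: pzalg_scaleAr. Qed.

Record right_coaction (k : comPzRingType) (M : lmodType k) (C : coalgType k)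
    (rho : {linear M -> M ⊗ C}) : Prop := RightCoaction {
  coactA : forall m, tassoc (tmap rho idfun (rho m)) = tmap idfun comul (rho m);
  coact1 : forall m, tlift (fun m' c => counit c *: m') (rho m) = m }.

(* [E] is automatically [k]-linear when [i] is a morphism of [k]-algebras. *)
Definition split_extension (B A : pzRingType) (i : {rmorphism B -> A}) : Prop :=
  exists E : {additive A -> B},
    [/\ E 1 = 1, forall b a, E (i b * a) = b * E a
      & forall a b, E (a * i b) = E a * b].

Section LeftAction.
Context (k : comPzRingType) (A : pzAlgType k) (C : lmodType k).

Definition lact (a : A) (t : A ⊗ C) : A ⊗ C :=
  tlift (fun x c => (a * x) ⊗ₜ c) t.

Lemma lact_balanced a : kbalanced (fun (x : A) (c : C) => (a * x) ⊗ₜ c).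
Proof.
split=> [x y c|x c d|x s c].
- by rewrite mulrDr tenskpDl.
- by rewrite tenskpDr.
- by rewrite -pzscalerAr tenskpS.
Qed.

Lemma lactE a x c : lact a (x ⊗ₜ c) = (a * x) ⊗ₜ c.
Proof. exact/tliftE/lact_balanced. Qed.

Lemma lact0 a : lact a 0 = 0.
Proof. exact/tlift0/lact_balanced. Qed.

Lemma lactDr a : {morph lact a : t u / t + u}.
Proof. exact/tliftD/lact_balanced. Qed.

Lemma lactDl t : {morph lact^~ t : a b / a + b}.
Proof.
move=> a b /=; elim/tensk_ind: t => [|x c|t u ht hu].
- by rewrite !lact0 addr0.
- by rewrite !lactE mulrDl tenskpDl.
- by rewrite !lactDr ht hu addrACA.
Qed.

Lemma lactM a b t : lact (a * b) t = lact a (lact b t).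
Proof.
elim/tensk_ind: t => [|x c|t u ht hu].
- by rewrite !lact0.
- by rewrite !lactE mulrA.
- by rewrite !lactDr ht hu.
Qed.

Lemma lact1 t : lact 1 t = t.
Proof.
elim/tensk_ind: t => [|x c|t u ht hu].
- by rewrite lact0.
- by rewrite lactE mul1r.
- by rewrite lactDr ht hu.
Qed.

Lemma lactZl s a t : lact (s *: a) t = s *: lact a t.
Proof.
elim/tensk_ind: t => [|x c|t u ht hu].
- by rewrite !lact0 scaler0.
- by rewrite !lactE tenskZl pzscalerAl.
- by rewrite !lactDr scalerDr ht hu.
Qed.

Lemma lactNl a t : lact (- a) t = - lact a t.
Proof. by rewrite -scaleN1r lactZl scaleN1r. Qed.

Lemma lactZr s a t : lact a (s *: t) = s *: lact a t.
Proof.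
apply: (tlift_scalable (lact_balanced a)) => b x c.
by rewrite -pzscalerAr tenskZl.
Qed.

End LeftAction.

Section CoalgebraGalois.
Context (k : comPzRingType) (A : pzAlgType k) (C : coalgType k).
Context (rho : {linear A -> A ⊗ C}).

Definition is_coinv (b : A) : bool :=
  `[< forall a, rho (b * a) = lact b (rho a) >].

Fact is_coinv_subring : subring_closed is_coinv.
Proof.
split=> [|x y /asboolP hx /asboolP hy|x y /asboolP hx /asboolP hy];
  apply/asboolP => a.
- by rewrite mul1r lact1.
- by rewrite mulrBl linearB hx hy lactDl lactNl.
- by rewrite -mulrA hx hy lactM.
Qed.

Fact is_coinv_scale : subsemimod_closed is_coinv.
Proof.
split=> [|s x /asboolP hx].
  split=> [|x y]; first by have [h1 hB _] := is_coinv_subring;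
    rewrite -(subrr 1); apply: hB.
  have [h1 hB _] := is_coinv_subring => hx hy.
  have h0 : 0 \in is_coinv by rewrite -(subrr 1); apply: hB.
  by rewrite -[y]opprK -[- y]sub0r; apply: (hB) => //; apply: hB.
by apply/asboolP => a; rewrite -pzscalerAl linearZ hx lactZl.
Qed.

Record coinv : Type := Coinv { coinv_val : A; _ : is_coinv coinv_val }.

HB.instance Definition _ := [isSub for coinv_val].
HB.instance Definition _ := [Choice of coinv by <:].
HB.instance Definition _ :=
  GRing.SubChoice_isSubPzRing.Build A is_coinv coinv is_coinv_subring.
HB.instance Definition _ :=
  GRing.SubZmodule_isSubLmodule.Build k A is_coinv coinv is_coinv_scale.

(* [A ⊗_B A] for the subalgebra [B] of coinvariants. *)
Definition tensB : Type :=
  tensor (fun (a : A) (b : coinv) => a * val b)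
         (fun (b : coinv) (a : A) => val b * a).

HB.instance Definition _ := GRing.Zmodule.on tensB.

Definition tensBp (a a' : A) : tensB := tpure _ _ a a'.

Definition can (t : tensB) : A ⊗ C := tlift (fun a a' => lact a (rho a')) t.

Lemma can_balanced :
  balanced (fun (a : A) (b : coinv) => a * val b)
    (fun (b : coinv) (a : A) => val b * a) (fun a a' => lact a (rho a')).
Proof.
split=> [a a' x|a x y|a b x].
- by rewrite lactDl.
- by rewrite linearD lactDr.
- by rewrite lactM; case: b => b /= /asboolP ->.
Qed.

Lemma canE a a' : can (tensBp a a') = lact a (rho a').
Proof. exact/tliftE/can_balanced. Qed.

Lemma canD : {morph can : t u / t + u}.
Proof. exact/tliftD/can_balanced. Qed.

Definition ractB (t : tensB) (a : A) : tensB :=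
  tlift (fun x y => tensBp x (y * a)) t.

Lemma ractB_balanced (a : A) :
  balanced (fun (x : A) (b : coinv) => x * val b)
    (fun (b : coinv) (y : A) => val b * y) (fun x y => tensBp x (y * a)).
Proof.
split=> [x x' y|x y y'|x b y].
- exact: tpureDl.
- by rewrite mulrDl; apply: tpureDr.
- by rewrite -mulrA; apply: tpureS.
Qed.

Lemma ractBE x y a : ractB (tensBp x y) a = tensBp x (y * a).
Proof. exact/tliftE/ractB_balanced. Qed.

Lemma ractBDl a : {morph ractB^~ a : t u / t + u}.
Proof. exact/tliftD/ractB_balanced. Qed.

Lemma ractB0 a : ractB 0 a = 0.
Proof. exact/tlift0/ractB_balanced. Qed.

Lemma ractBDr t a a' : ractB t (a + a') = ractB t a + ractB t a'.
Proof.
elim/tensor_ind: t => [|x y|t u ht hu].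
- by rewrite !ractB0 addr0.
- by rewrite !ractBE mulrDr; apply: tpureDr.
- by rewrite !ractBDl ht hu addrACA.
Qed.

Lemma ractBA t a a' : ractB (ractB t a) a' = ractB t (a * a').
Proof.
elim/tensor_ind: t => [|x y|t u ht hu].
- by rewrite !ractB0.
- by rewrite !ractBE mulrA.
- by rewrite !ractBDl ht hu.
Qed.

Lemma can_ractBZ t (s : k) : can (ractB t (s *: (1 : A))) = s *: can t.
Proof.
have can0 : can 0 = 0 by apply/tlift0/can_balanced.
elim/tensor_ind: t => [|x y|t u ht hu].
- by rewrite ractB0 can0 scaler0.
- by rewrite ractBE !canE -pzscalerAr mulr1 linearZ lactZr.
- by rewrite ractBDl !canD ht hu scalerDr.
Qed.

Record coalgebra_Galois : Prop := CoalgebraGalois {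
  Galois_coaction : right_coaction rho;
  Galois_can : bijective can }.

(* The inverse of [can]; meaningful only when [can] is bijective. *)
Definition can_inv (y : A ⊗ C) : tensB := xget 0 [set t | can t = y]%classic.

Lemma can_invK : bijective can -> cancel can can_inv /\ cancel can_inv can.
Proof.
case=> g gK Kg; have canK y : can (can_inv y) = y.
  by apply: (@xgetPex _ 0 [set t | can t = y]%classic); exists (g y).
by split=> // t; apply: (can_inj gK); rewrite canK.
Qed.

Definition psi (t : C ⊗ A) : A ⊗ C :=
  tlift (fun (c : C) (a : A) => can (ractB (can_inv ((1 : A) ⊗ₜ c)) a)) t.

Lemma psi_balanced : bijective can ->
  kbalanced (fun (c : C) (a : A) => can (ractB (can_inv ((1 : A) ⊗ₜ c)) a)).
Proof.
move=> /can_invK [canK Kcan].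
have invD y z : can_inv (y + z) = can_inv y + can_inv z.
  by rewrite -[in LHS](Kcan y) -[in LHS](Kcan z) -canD canK.
have invZ (s : k) y : can_inv (s *: y) = ractB (can_inv y) (s *: (1 : A)).
  by rewrite -[in LHS](Kcan y) -can_ractBZ canK.
split=> [c c' a|c a a'|c s a].
- by rewrite tenskpDr invD ractBDl canD.
- by rewrite ractBDr canD.
- by rewrite -tenskpS -tenskZl invZ ractBA -pzscalerAl mul1r.
Qed.

Lemma psiE c a : bijective can ->
  psi (c ⊗ₜ a) = can (ractB (can_inv ((1 : A) ⊗ₜ c)) a).
Proof. by move=> hcan; exact/tliftE/psi_balanced. Qed.

(* With [t = sum_i a_i ⊗ c_i], this is [sum_i a_i * phi c_i]. *)
Definition mulphi (phi : {linear C -> A}) (t : A ⊗ C) : A :=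
  tlift (fun a c => a * phi c) t.

Lemma mulphi_balanced (phi : {linear C -> A}) :
  kbalanced (fun (a : A) (c : C) => a * phi c).
Proof.
split=> [a a' c|a c c'|a s c].
- exact: mulrDl.
- by rewrite linearD mulrDr.
- by rewrite linearZ -pzscalerAl pzscalerAr.
Qed.

Lemma mulphiE (phi : {linear C -> A}) a c : mulphi phi (a ⊗ₜ c) = a * phi c.
Proof. exact/tliftE/mulphi_balanced. Qed.

End CoalgebraGalois.

(* Main.v *)
Require Import Defs.
From HB Require Import structures.
From mathcomp Require Import all_boot all_order all_algebra.
From mathcomp Require Import boolp.

Set Implicit Arguments.
Unset Strict Implicit.
Unset Printing Implicit Defensive.

Import GRing.Theory.
Local Open Scope ring_scope.

(** Transporting the right multiplication of [A ⊗_B A] along [can] makes [A ⊗ C]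
    an [(A, A)]-bimodule for which [rho] is right [A]-linear; the canonical
    entwining map [psi] is this right action restricted to [1 ⊗ C].

    A left [A]-linear map [A ⊗ C -> A] is the same as a linear map
    [phi : C -> A], through [mulphi phi]; on the other side of [can], it is the
    same as a left [B]-linear map [E : A -> A], through [x ⊗_B y |-> x * E y].
    So [E] and [phi] determine each other, with [E a = mulphi phi (rho a)].
    Under this correspondence, (ii) says that [E 1 = 1], and (iii) that [E] is
    right [B]-linear.  Condition (i) says that [E] takes its values in [B]:
    coassociativity of [rho] gives
      [rho (E a) = a_(0) psi (a_(1) ⊗ phi a_(2))] ([rho_mulphi]),
    so (i) amounts to [rho (E a) = E a * rho 1], which by right [A]-linearity of
    [rho] means that [E a] is coinvariant ([coinvP]). *)

(** * Additivity of maps between tensor products *)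

Section TensorMapsLinear.
Context (k : comPzRingType).

Section Tmap.
Context (M M' N N' : lmodType k) (f : {linear M -> M'}) (g : {linear N -> N'}).

Lemma tmapD : {morph tmap f g : v w / v + w}.
Proof. exact/tliftD/tmap_balanced. Qed.

Lemma tmap0 : tmap f g 0 = 0.
Proof. exact/tlift0/tmap_balanced. Qed.

Lemma tmapZ s (v : M ⊗ N) :
  tmap f g (s *: v) = s *: tmap f g v.
Proof.
apply: (tlift_scalable (tmap_balanced f g)) => b m n.
by rewrite linearZ tenskZl.
Qed.

End Tmap.

Section Tassoc.
Context (M N P : lmodType k).

Lemma tassoc0 : @tassoc k M N P 0 = 0.
Proof. exact/tlift0/tassoc_balanced. Qed.

Lemma tassocD : {morph @tassoc k M N P : v w / v + w}.
Proof. exact/tliftD/tassoc_balanced. Qed.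

End Tassoc.

Lemma lact0l (A : pzAlgType k) (C : lmodType k) (t : A ⊗ C) : lact 0 t = 0.
Proof. by rewrite -(scale0r (0 : A)) lactZl scale0r. Qed.

End TensorMapsLinear.

(** * The right action of the algebra on its tensor product with the coalgebra *)

Section Entwining.
Context (k : comPzRingType) (A : pzAlgType k) (C : coalgType k).
Context (rho : {linear A -> A ⊗ C}) (bij_can : bijective (@can k A C rho)).
Implicit Types (a x y : A) (c : C) (t u : A ⊗ C).

Let canK := (can_invK bij_can).1.
Let can_invKV := (can_invK bij_can).2.

(** Since [can] is onto, an additive identity on [A ⊗ C] need only be checked on
    the elements [x * rho y]. *)
Lemma can_ind (P : A ⊗ C -> Prop) : P 0 ->
  (forall x y, P (lact x (rho y))) -> (forall t u, P t -> P u -> P (t + u)) ->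
  forall t, P t.
Proof.
move=> P0 Pp PD t; rewrite -[t]can_invKV.
elim/tensor_ind: (can_inv rho t) => [|x y|v w hv hw].
- by rewrite /can (tlift0 (can_balanced rho)).
- by rewrite [can _]canE.
- by rewrite (canD v w); apply: PD.
Qed.

Lemma can_invD : {morph can_inv rho : t u / t + u}.
Proof.
move=> t u; rewrite -[in LHS](can_invKV t) -[in LHS](can_invKV u).
by rewrite -(canD (can_inv rho t)) canK.
Qed.

Lemma can_inv_lact_rho x y : can_inv rho (lact x (rho y)) = tensBp rho x y.
Proof. by rewrite -canE canK. Qed.

(** The right [A]-module structure which the entwining map puts on [A ⊗ C],
    [(x ⊗ c) a = x psi (c ⊗ a)] (see [ractE]).  Defining it through [can] makes
    its associativity with the left action and the right [A]-linearity of [rho]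
    immediate. *)
Definition ract t a : A ⊗ C := can (ractB (can_inv rho t) a).

Lemma ract_lact_rho x y a : ract (lact x (rho y)) a = lact x (rho (y * a)).
Proof. by rewrite /ract can_inv_lact_rho ractBE canE. Qed.

Lemma ract_rho y a : ract (rho y) a = rho (y * a).
Proof. by rewrite -[rho y]lact1 ract_lact_rho lact1. Qed.

Lemma ractDl a : {morph ract^~ a : t u / t + u}.
Proof. by move=> t u; rewrite /ract can_invD ractBDl; apply: canD. Qed.

Lemma ract0 a : ract 0 a = 0.
Proof. by apply: (addIr (ract 0 a)); rewrite -ractDl !add0r. Qed.

Lemma ractDr t a a' : ract t (a + a') = ract t a + ract t a'.
Proof. by rewrite /ract ractBDr; apply: canD. Qed.

Lemma lact_ract x t a : lact x (ract t a) = ract (lact x t) a.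
Proof.
elim/can_ind: t => [|y z|t u ht hu].
- by rewrite ract0 lact0 ract0.
- by rewrite -lactM !ract_lact_rho lactM.
- by rewrite ractDl !lactDr ractDl ht hu.
Qed.

Lemma ractZr s t a : ract t (s *: a) = s *: ract t a.
Proof.
elim/can_ind: t => [|y z|t u ht hu].
- by rewrite !ract0 scaler0.
- by rewrite !ract_lact_rho -pzscalerAr linearZ lactZr.
- by rewrite !ractDl scalerDr ht hu.
Qed.

Lemma ractZl s t a : ract (s *: t) a = s *: ract t a.
Proof.
have lactE1 (v : A ⊗ C) : s *: v = lact (s *: (1 : A)) v by rewrite lactZl lact1.
by rewrite !lactE1 lact_ract.
Qed.

Lemma psi_ract c a : psi rho (c ⊗ₜ a) = ract ((1 : A) ⊗ₜ c) a.
Proof. exact: psiE. Qed.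

Lemma ractE x c a : ract (x ⊗ₜ c) a = lact x (psi rho (c ⊗ₜ a)).
Proof. by rewrite psi_ract lact_ract lactE mulr1. Qed.

Lemma psi0 : psi rho 0 = 0.
Proof. exact/tlift0/psi_balanced. Qed.

Lemma psiD : {morph psi rho : v w / v + w}.
Proof. exact/tliftD/psi_balanced. Qed.

Lemma psiZ s (v : C ⊗ A) : psi rho (s *: v) = s *: psi rho v.
Proof.
elim/tensk_ind: v => [|c a|v w hv hw].
- by rewrite scaler0 psi0 scaler0.
- by rewrite tenskZl tenskpS !psi_ract ractZr.
- by rewrite scalerDr !psiD scalerDr hv hw.
Qed.

(** Right [A]-linearity of [rho] propagates the condition from [1] to every [a]. *)
Lemma coinvP b : reflect (rho b = lact b (rho 1)) (is_coinv rho b).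
Proof.
apply: (iffP idP) => [/asboolP/(_ 1)|hb]; first by rewrite mulr1.
by apply/asboolP => a; rewrite -ract_rho hb -lact_ract ract_rho mul1r.
Qed.

(** * Left linear maps determined by a linear map on the coalgebra *)

Section Phi.
Variable phi : {linear C -> A}.

Lemma mulphi0 : mulphi phi 0 = 0.
Proof. exact/tlift0/mulphi_balanced. Qed.

Lemma mulphiD : {morph mulphi phi : t u / t + u}.
Proof. exact/tliftD/mulphi_balanced. Qed.

Lemma mulphiN t : mulphi phi (- t) = - mulphi phi t.
Proof. exact/tliftN/mulphi_balanced. Qed.

Lemma mulphi_lact x t : mulphi phi (lact x t) = x * mulphi phi t.
Proof.
elim/tensk_ind: t => [|y c|t u ht hu].
- by rewrite lact0 mulphi0 mulr0.
- by rewrite lactE !mulphiE mulrA.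
- by rewrite lactDr !mulphiD mulrDr ht hu.
Qed.

(** The map [x ⊗ c |-> x * psi (c_(1) ⊗ phi c_(2))], the left [A]-linear
    extension of the left-hand side of condition (i). *)
Definition psiphi t : A ⊗ C :=
  tlift (fun x c => lact x (psi rho (tmap idfun phi (comul c)))) t.

Lemma psiphi_balanced_in :
  kbalanced (fun x (d : C ⊗ C) => lact x (psi rho (tmap idfun phi d))).
Proof.
split=> [x y d|x d d'|x s d].
- by rewrite lactDl.
- by rewrite tmapD psiD lactDr.
- by rewrite lactZl tmapZ psiZ lactZr.
Qed.

Lemma psiphi_balanced :
  kbalanced (fun x c => lact x (psi rho (tmap idfun phi (comul c)))).
Proof.
case: psiphi_balanced_in => hl hr hs.
split=> [x y c|x c d|x s c]; first exact: hl.
- by rewrite linearD hr.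
- by rewrite linearZ hs.
Qed.

Lemma psiphiE x c :
  psiphi (x ⊗ₜ c) = lact x (psi rho (tmap idfun phi (comul c))).
Proof. exact/tliftE/psiphi_balanced. Qed.

Lemma psiphi0 : psiphi 0 = 0.
Proof. exact/tlift0/psiphi_balanced. Qed.

Lemma psiphiD : {morph psiphi : t u / t + u}.
Proof. exact/tliftD/psiphi_balanced. Qed.

Lemma psiphi_lact x t : psiphi (lact x t) = lact x (psiphi t).
Proof.
elim/tensk_ind: t => [|y c|t u ht hu].
- by rewrite lact0 psiphi0 lact0.
- by rewrite lactE !psiphiE lactM.
- by rewrite lactDr !psiphiD lactDr ht hu.
Qed.

Lemma ract_balanced : kbalanced (fun t c => ract t (phi c)).
Proof.
split=> [t u c|t c d|t s c]; first exact: ractDl.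
- by rewrite linearD ractDr.
- by rewrite linearZ ractZl ractZr.
Qed.

Lemma ract_rho_mulphi t :
  tlift (fun v c => ract v (phi c)) (tmap rho idfun t) = rho (mulphi phi t).
Proof.
elim/tensk_ind: t => [|x c|t u ht hu].
- by rewrite tmap0 (tlift0 ract_balanced) mulphi0 linear0.
- by rewrite tmapE (tliftE ract_balanced) ract_rho mulphiE.
- by rewrite tmapD (tliftD ract_balanced) mulphiD linearD ht hu.
Qed.

Lemma ract_tassoc (w : (A ⊗ C) ⊗ C) :
  tlift (fun v c => ract v (phi c)) w =
  tlift (fun x (d : C ⊗ C) => lact x (psi rho (tmap idfun phi d))) (tassoc w).
Proof.
have hl := ract_balanced; have hr := psiphi_balanced_in.
elim/tensk_ind: w => [|t c|w w' hw hw'].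
- by rewrite tassoc0 (tlift0 hl) (tlift0 hr).
- rewrite (tliftE hl); elim/tensk_ind: t => [|x d|t u ht hu].
  + by rewrite ract0 /tenskp tpure0l tassoc0 (tlift0 hr).
  + by rewrite ractE tassocE (tliftE hr) tmapE.
  + rewrite (ractDl (phi c) t u) (tenskpDl t u c).
    by rewrite (tassocD (t ⊗ₜ c) (u ⊗ₜ c)) (tliftD hr) ht hu.
- by rewrite (tassocD w w') (tliftD hl) (tliftD hr) hw hw'.
Qed.

Lemma psiphi_tmap t :
  tlift (fun x (d : C ⊗ C) => lact x (psi rho (tmap idfun phi d)))
    (tmap idfun comul t) = psiphi t.
Proof.
have hr := psiphi_balanced_in.
elim/tensk_ind: t => [|x c|t u ht hu].
- by rewrite tmap0 (tlift0 hr) psiphi0.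
- by rewrite tmapE (tliftE hr) psiphiE.
- by rewrite tmapD (tliftD hr) psiphiD ht hu.
Qed.

(** Both sides evaluate [x ⊗ c ⊗ c' |-> x * psi (c ⊗ phi c')] at the two
    coassociative forms of [a_(0) ⊗ a_(1) ⊗ a_(2)]; on the left, right
    [A]-linearity gives
      [a_(0)(0) psi (a_(0)(1) ⊗ phi a_(1)) = rho (a_(0) phi a_(1))]. *)
Lemma rho_mulphi : right_coaction rho ->
  forall a, rho (mulphi phi (rho a)) = psiphi (rho a).
Proof.
by move=> co a; rewrite -ract_rho_mulphi ract_tassoc (coactA co) psiphi_tmap.
Qed.

End Phi.

(** * From a bimodule retraction to a map on the coalgebra *)

Section Retraction.
Variable E : {additive A -> coinv rho}.
Hypothesis E_lin : forall (b : coinv rho) a, E (val b * a) = b * E a.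

Lemma retraction_balanced :
  balanced (fun x (b : coinv rho) => x * val b)
    (fun (b : coinv rho) y => val b * y) (fun x y => x * val (E y)).
Proof.
split=> [x x' y|x y y'|x b y]; first exact: mulrDl.
- by rewrite !raddfD mulrDr.
- by rewrite E_lin -mulrA.
Qed.

(** The map [x ⊗_B y |-> x * E y], well defined because [E] is left [B]-linear,
    read on the other side of [can]. *)
Definition can_retraction t : A :=
  tlift (fun x y => x * val (E y)) (can_inv rho t).

Lemma can_retractionE x y : can_retraction (lact x (rho y)) = x * val (E y).
Proof.
by rewrite /can_retraction can_inv_lact_rho [LHS](tliftE retraction_balanced).
Qed.

Lemma can_retractionD : {morph can_retraction : t u / t + u}.
Proof.
by move=> t u; rewrite /can_retraction can_invD (tliftD retraction_balanced).
Qed.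

Lemma can_retraction0 : can_retraction 0 = 0.
Proof.
by apply: (addIr (can_retraction 0)); rewrite -can_retractionD !add0r.
Qed.

Lemma can_retraction_lact x t :
  can_retraction (lact x t) = x * can_retraction t.
Proof.
elim/can_ind: t => [|y z|t u ht hu].
- by rewrite lact0 can_retraction0 mulr0.
- by rewrite -lactM !can_retractionE mulrA.
- by rewrite lactDr !can_retractionD mulrDr ht hu.
Qed.

(** In terms of the translation map [c |-> c^(1) ⊗_B c^(2)], the inverse of
    [can] on [1 ⊗ C], this is [c^(1) * E c^(2)]. *)
Definition phi_of c : A := can_retraction ((1 : A) ⊗ₜ c).

Lemma phi_of_linear : linear phi_of.
Proof.
move=> s c d; rewrite /phi_of tenskpDr can_retractionD -tenskpS.
by rewrite -[s *: (1 : A)]mulr1 -lactE can_retraction_lact -pzscalerAl mul1r.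
Qed.

HB.instance Definition _ := GRing.isLinear.Build k C A _ phi_of phi_of_linear.

(** The linear structure of [phi_of] depends on the bijectivity of [can] and the
    left [B]-linearity of [E], which inference cannot recover from the function
    alone; hence the bundled form. *)
Definition phi_lin : {linear C -> A} := phi_of.

Lemma mulphi_phi_lin t : mulphi phi_lin t = can_retraction t.
Proof.
elim/tensk_ind: t => [|x c|t u ht hu].
- by rewrite mulphi0 can_retraction0.
- by rewrite mulphiE -can_retraction_lact lactE mulr1.
- by rewrite mulphiD can_retractionD ht hu.
Qed.

Lemma mulphi_phi_lin_rho a : mulphi phi_lin (rho a) = val (E a).
Proof. by rewrite mulphi_phi_lin -[rho a]lact1 can_retractionE mul1r. Qed.

(** Condition (i), extended left [A]-linearly so that it can be checked on
    [x * rho y], where it says that [E y] is coinvariant. *)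
Lemma psiphi_phi_lin : right_coaction rho ->
  forall t, psiphi phi_lin t = lact (mulphi phi_lin t) (rho 1).
Proof.
move=> co; elim/can_ind => [|x y|t u ht hu].
- by rewrite psiphi0 mulphi0 lact0l.
- rewrite psiphi_lact -rho_mulphi // mulphi_lact mulphi_phi_lin_rho lactM.
  by congr lact; apply/coinvP; case: (E y).
- by rewrite psiphiD mulphiD lactDl ht hu.
Qed.

(** Condition (iii), extended left [A]-linearly so that it can be checked on
    [x * rho y], where it is the right [B]-linearity of [E]. *)
Lemma can_retraction_ract (b : coinv rho) :
  (forall a, E (a * val b) = E a * b) ->
  forall t, can_retraction (ract t (val b)) = can_retraction t * val b.
Proof.
move=> Eb; elim/can_ind => [|x y|t u ht hu].
- by rewrite ract0 can_retraction0 mul0r.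
- by rewrite ract_lact_rho !can_retractionE Eb mulrA.
- by rewrite ractDl !can_retractionD mulrDl ht hu.
Qed.

End Retraction.

(** * From a map on the coalgebra to a bimodule retraction *)

Section Splitting.
Variable phi : {linear C -> A}.

Lemma psiphi_coinv :
  (forall c, psi rho (tmap idfun phi (comul c)) = lact (phi c) (rho 1)) ->
  forall t, psiphi phi t = lact (mulphi phi t) (rho 1).
Proof.
move=> h; elim/tensk_ind => [|x c|t u ht hu].
- by rewrite psiphi0 mulphi0 lact0l.
- by rewrite psiphiE h mulphiE lactM.
- by rewrite psiphiD mulphiD lactDl ht hu.
Qed.

Lemma mulphi_ract b :
  (forall c, mulphi phi (psi rho (c ⊗ₜ b)) = phi c * b) ->
  forall t, mulphi phi (ract t b) = mulphi phi t * b.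
Proof.
move=> h; elim/tensk_ind => [|x c|t u ht hu].
- by rewrite ract0 mulphi0 mul0r.
- by rewrite ractE mulphi_lact h mulphiE mulrA.
- by rewrite ractDl !mulphiD mulrDl ht hu.
Qed.

Hypothesis phi_coinv : forall a, is_coinv rho (mulphi phi (rho a)).

Definition splitting a : coinv rho := Coinv (phi_coinv a).

Lemma splitting_is_zmod_morphism : zmod_morphism splitting.
Proof.
by move=> x y; apply: val_inj; rewrite raddfB /= linearB /= mulphiD mulphiN.
Qed.

HB.instance Definition _ :=
  GRing.isZmodMorphism.Build A (coinv rho) splitting splitting_is_zmod_morphism.

Lemma splitting_linear (b : coinv rho) a :
  splitting (val b * a) = b * splitting a.
Proof.
apply: val_inj; rewrite /= -mulphi_lact.
by case: b => b hb; move/asboolP: (hb) => /= ->.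
Qed.

End Splitting.

End Entwining.

Theorem proposition5p6 (k : comPzRingType) (A : pzAlgType k) (C : coalgType k)
    (rho : {linear A -> A ⊗ C}) (hGalois : coalgebra_Galois rho) :
  split_extension (val : coinv rho -> A) <->
  exists phi : {linear C -> A},
    [/\ forall c : C, psi rho (tmap idfun phi (comul c)) = lact (phi c) (rho 1),
        mulphi phi (rho 1) = 1
      & forall (b : coinv rho) (c : C),
          mulphi phi (psi rho (c ⊗ₜ val b)) = phi c * val b].
Proof.
case: hGalois => co bij_can; split=> [[E [E1 El Er]]|[phi [phi1 phi2 phi3]]].
  exists (phi_lin bij_can El); split=> [c||b c].
  - have := psiphi_phi_lin bij_can El co ((1 : A) ⊗ₜ c).
    by rewrite psiphiE // mulphiE lact1 mul1r.
  - by rewrite mulphi_phi_lin_rho E1.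
  - rewrite mulphi_phi_lin psi_ract // can_retraction_ract //.
    by move=> a; apply: Er.
have coE a : is_coinv rho (mulphi phi (rho a)).
  by apply/(coinvP bij_can); rewrite (rho_mulphi bij_can) // psiphi_coinv.
exists (splitting coE); split=> [|b a|a b].
- exact: val_inj.
- exact: splitting_linear.
- apply: val_inj; rewrite /= -(ract_rho bij_can).
  by apply: mulphi_ract => // c; apply: phi3.
Qed.
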